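(* Let $\mathbf{M}=(M_0,M_1,\ldots,M_k)$, $M_i\in\mathbb{R}^{n\times n}$, have the row $\mathcal{W}$-property, let $\mathbf{q}=(q_0,\ldots,q_k)$ with $q_i\in\mathbb{R}^n$, and let the perturbations $\Delta M_i\in\mathbb{R}^{n\times n}$ and $\Delta q_i\in\mathbb{R}^n$ satisfy $\|\Delta M_i\|\le\epsilon_i\|M_i\|$ and $\|\Delta q_i\|\le\epsilon_i\|(-q_i)_+\|$, respectively, for $i=0,1,\ldots,k$, where $\epsilon_i\ge 0$. If the $\epsilon_i$ are small enough that $$\eta:=\sum_{i=0}^k\epsilon_i\,\alpha_i(\mathbf{M})\,\|M_i\|<1,$$ then: (i) $\tilde{\mathbf{M}}=(M_0+\Delta M_0,M_1+\Delta M_1,\ldots,M_k+\Delta M_k)$ has the row $\mathcal{W}$-property. (ii) Let $x$ and $y$ be the solutions of EVLCP $(\mathbf{M},\mathbf{q})$ and EVLCP $(\tilde{\mathbf{M}},\tilde{\mathbf{q}})$, respectively, where $\tilde{\mathbf{q}}=(q_0+\Delta q_0,\ldots,q_k+\Delta q_k)$. Then $$\frac{\|x-y\|}{\|x\|}\le\frac{2\eta}{1-\eta}.$$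
   Context: EVLCP $(\mathbf{M},\mathbf{q})$, for $\mathbf{M}=(M_0,\ldots,M_k)$ with $M_i\in\mathbb{R}^{n\times n}$ and $\mathbf{q}=(q_0,\ldots,q_k)$ with $q_i\in\mathbb{R}^n$, is the problem of finding $x\in\mathbb{R}^n$ with $\min\{M_0x+q_0,M_1x+q_1,\ldots,M_kx+q_k\}=0$, where $\min$ is the componentwise minimum. $\mathbf{M}$ has the row $\mathcal{W}$-property if $\min(M_0x,\ldots,M_kx)\le 0\le \max(M_0x,\ldots,M_kx)$ (componentwise min, max and inequalities) implies $x=0$; in that case EVLCP $(\mathbf{M},\mathbf{q})$ has a unique solution for every $\mathbf{q}$. $\mathcal{D}$ is the set of all tuples $(D_0,\ldots,D_k)$ of $n\times n$ diagonal matrices with diagonal entries in $[0,1]$ and $\sum_{i=0}^kD_i=I$. For $(D_0,\ldots,D_k)\in\mathcal{D}$ put $S_{\mathbf{M}}=\sum_{i=0}^kD_iM_i$ (nonsingular for every such tuple when $\mathbf{M}$ has the row $\mathcal{W}$-property), and $\alpha_i(\mathbf{M})=\max_{(D_0,\ldots,D_k)\in\mathcal{D}}\|S_{\mathbf{M}}^{-1}D_i\|$. For a vector $q$, $q_+=\max\{0,q\}$ componentwise. $\|\cdot\|$ denotes a fixed vector $p$-norm with $p\ge 1$ ($p=\infty$ allowed) and, for matrices, its induced operator norm. *)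

(* Defs.v *)
From mathcomp Require Import all_boot all_order all_algebra.
From mathcomp Require Import all_classical all_reals all_analysis.

Set Implicit Arguments.
Unset Strict Implicit.
Unset Printing Implicit Defensive.

Import Order.TTheory GRing.Theory Num.Theory.
Local Open Scope classical_set_scope.
Local Open Scope ring_scope.

Section EVLCP.
Context {R : realType} {n : nat}.

(* Only used for 1 <= p; the value at p = -oo is junk. *)
Definition pnorm (p : \bar R) (x : 'cV[R]_n) : R :=
  match p with
  | r%:E => (\sum_(j < n) `|x j 0| `^ r) `^ r^-1
  | +oo%E => \big[Num.max/0]_(j < n) `|x j 0|
  | -oo%E => 0
  end.

Definition opnorm (p : \bar R) (A : 'M[R]_n) : R :=
  sup [set pnorm p (A *m x) | x in [set x | pnorm p x <= 1]].

Definition pos_part (q : 'cV[R]_n) : 'cV[R]_n := \col_j Num.max 0 (q j 0).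

Section Tuples.
Context {k : nat}.

(* The default element of the big operator is the term of index 0, so that
   these are the true min and max of the k+1 vectors. *)
Definition min_col (v : 'I_k.+1 -> 'cV[R]_n) : 'cV[R]_n :=
  \col_j \big[Num.min/v ord0 j 0]_(i < k.+1) v i j 0.

Definition max_col (v : 'I_k.+1 -> 'cV[R]_n) : 'cV[R]_n :=
  \col_j \big[Num.max/v ord0 j 0]_(i < k.+1) v i j 0.

Definition solves_EVLCP (M : 'I_k.+1 -> 'M[R]_n) (q : 'I_k.+1 -> 'cV[R]_n)
    (x : 'cV[R]_n) : Prop :=
  min_col (fun i => M i *m x + q i) = 0.

Definition row_W_property (M : 'I_k.+1 -> 'M[R]_n) : Prop :=
  forall x : 'cV[R]_n,
    (forall j, min_col (fun i => M i *m x) j 0 <= 0) ->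
    (forall j, 0 <= max_col (fun i => M i *m x) j 0) ->
    x = 0.

Definition diag_partition : set ('I_k.+1 -> 'M[R]_n) :=
  [set D | [/\ forall i, is_diag_mx (D i),
               forall i j, 0 <= D i j j <= 1
             & \sum_(i < k.+1) D i = 1%:M]].

Definition S_mx (M D : 'I_k.+1 -> 'M[R]_n) : 'M[R]_n :=
  \sum_(i < k.+1) D i *m M i.

(* Under the row W-property every S_mx M D is invertible, and the supremum is
   a maximum because diag_partition is nonempty and compact. *)
Definition alpha (p : \bar R) (M : 'I_k.+1 -> 'M[R]_n) (i : 'I_k.+1) : R :=
  sup [set opnorm p (invmx (S_mx M D) *m D i) | D in diag_partition].

End Tuples.
End EVLCP.

(* Main.v *)
Require Import Defs.
From mathcomp Require Import all_boot all_order all_algebra.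
From mathcomp Require Import all_classical all_reals all_analysis.
From mathcomp Require Import ring lra.
Import Order.TTheory GRing.Theory Num.Theory.
Local Open Scope ring_scope.

(** Everything rests on one remark: if, in every coordinate, a family of vectors
    [u i] takes both a nonpositive and a nonnegative value, then some tuple [D]
    of the diagonal partitions satisfies [\sum_i D i *m u i = 0]
    ([diag_partition_zero]).  It turns the min/max conditions into a linear
    equation with matrix [S_mx M D], which the row W-property makes invertible.

    For (i), let [z] violate the property for the perturbed tuple.  The remark
    applied to [(M i + dM i) *m z] gives [S_mx M D *m z = - \sum_i D i *m dM i *m z].
    Multiplying by the inverse and using
    [opnorm (invmx (S_mx M D) *m D i) <= alpha i] gives
    [pnorm z <= eta * pnorm z], so [z = 0] since [eta < 1].

    For (ii), compare the two families of residuals.  In each coordinate some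
    residual of [x] vanishes while that of [y] is nonnegative, and conversely, so
    the remark applies to their differences and yields
    [S_mx M D *m (x - y) = \sum_i D i *m (dM i *m y + dq i)]
    ([solutions_difference]).  As [M i *m x + q i >= 0], the vector [(- q i)_+] is
    dominated by [|M i *m x|], hence [pnorm (x - y) <= eta * (pnorm y + pnorm x)]
    and the triangle inequality for [y = x - (x - y)] finishes.

    The suprema that define [opnorm] and [alpha] bound their members only if the
    sets are bounded above.  For [alpha] this requires a bound on
    [invmx (S_mx M D)] that is uniform in [D].  It comes from the adjugate formula
    and a lower bound on [|\det (S_mx M D)|]: this determinant is a convex
    combination of its values at the finitely many vertices of the set of
    partitions ([det_S_mx]), and these values are nonzero and of one sign, since a
    sign change along a segment would produce a singular [S_mx M D]
    ([S_mx_det_same_sign]). *)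

(** * The p-norm on column vectors *)

Lemma powR_mono (R : realType) (r a b : R) :
  0 <= r -> 0 <= a -> a <= b -> a `^ r <= b `^ r.
Proof.
by move=> r0 a0 ab; apply: ge0_ler_powR; rewrite ?nnegrE // (le_trans a0).
Qed.

(** Minkowski's inequality before summation: [(a + b) / (A + B)] is the convex
    combination of [a / A] and [b / B] with weights [A / (A + B)] and
    [B / (A + B)], and [t |-> t `^ r] is convex. With [A] and [B] the norms of two
    vectors, the right-hand sides sum to [(A + B) `^ r]. *)
Lemma powR_add_le (R : realType) (r a b A B : R) :
  1 <= r -> 0 <= a -> 0 <= b -> 0 < A -> 0 < B ->
  (a + b) `^ r <=
    (A + B) `^ r * (A / (A + B) * (a `^ r / A `^ r) +
                    B / (A + B) * (b `^ r / B `^ r)).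
Proof.
move=> r1 a0 b0 A0 B0.
have AB0 : 0 < A + B by exact: addr_gt0.
have t0 : 0 <= A / (A + B) by rewrite divr_ge0 // ltW.
have t1 : A / (A + B) <= 1 by rewrite ler_pdivrMr // mul1r lerDl ltW.
have tN : 1 - A / (A + B) = B / (A + B) by field; rewrite gt_eqF.
have divX (c C : R) : 0 <= c -> 0 < C -> c `^ r / C `^ r = (c / C) `^ r.
  move=> c0 C0; rewrite powRM ?invr_ge0 ?(ltW C0) //; congr (_ * _).
  by rewrite -[C^-1]powR_inv1 ?(ltW C0) // -powRrM mulN1r powRN.
have -> : a + b = (A + B) * (A / (A + B) * (a / A) + B / (A + B) * (b / B)).
  by field; rewrite !gt_eqF.
have aA0 : 0 <= a / A by rewrite divr_ge0 // ltW.
have bB0 : 0 <= b / B by rewrite divr_ge0 // ltW.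
rewrite powRM ?(ltW AB0) //; last first.
  by rewrite addr_ge0 // mulr_ge0 // divr_ge0 // ltW.
rewrite ler_wpM2l ?powR_ge0 // !divX //.
have := convex_powR r1 (Itv01 t0 t1) (x := a / A) (y := b / B).
rewrite !inE /= !in_itv /= !andbT => /(_ aA0 bB0).
by rewrite !convRE /= -tN.
Qed.

Section PNorm.
Context {R : realType} {n : nat} (p : \bar R) (hp : (1 <= p)%E).
Implicit Types x y : 'cV[R]_n.

Lemma sum_powR_ge0 r x : 0 <= \sum_(j < n) `|x j 0| `^ r.
Proof. by apply: sumr_ge0 => j _; exact: powR_ge0. Qed.

Lemma pnorm_ge0 x : 0 <= pnorm p x.
Proof.
case: p => [r||] //=; first exact: powR_ge0.
by apply: (big_ind (fun a => 0 <= a)) => // a b ha hb; rewrite le_max ha.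
Qed.

Lemma exponent_cases : (exists2 r : R, 1 <= r & p = r%:E) \/ p = +oo%E.
Proof.
case: p hp => [r||]; rewrite ?lee_fin //; last by right.
by left; exists r.
Qed.

Lemma pnorm_mono x y : (forall j, `|x j 0| <= `|y j 0|) -> pnorm p x <= pnorm p y.
Proof.
move=> hxy; have [[r r1 ->]|->] := exponent_cases; rewrite /pnorm.
  have r0 : 0 <= r by exact: le_trans r1.
  apply: powR_mono; [by rewrite invr_ge0|exact: sum_powR_ge0|].
  by apply: ler_sum => j _; exact: powR_mono.
by apply: le_bigmax2 => j _; exact: hxy.
Qed.

Lemma pnormZ a x : pnorm p (a *: x) = `|a| * pnorm p x.
Proof.
have [[r r1 ->]|->] := exponent_cases; rewrite /pnorm; last first.
  rewrite (big_morph ( *%R `|a|) (id1 := 0) (op1 := Num.max)) ?mulr0 //.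
    by apply: eq_bigr => j _; rewrite mxE normrM.
  by move=> u v; rewrite maxr_pMr.
have r0 : r != 0 by rewrite gt_eqF // (lt_le_trans ltr01).
under eq_bigr do rewrite mxE normrM powRM //.
rewrite -mulr_sumr powRM ?powR_ge0 ?sum_powR_ge0 // -powRrM mulfV // powRr1 //.
Qed.

Lemma pnormN x : pnorm p (- x) = pnorm p x.
Proof. by rewrite -scaleN1r pnormZ normrN normr1 mul1r. Qed.

Lemma pnorm0 : pnorm p (0 : 'cV[R]_n) = 0.
Proof. by rewrite -(scale0r 0) pnormZ normr0 mul0r. Qed.

Lemma coord_le_pnorm x j : `|x j 0| <= pnorm p x.
Proof.
have [[r r1 ->]|->] := exponent_cases; rewrite /pnorm; last first.
  exact: (le_bigmax _ (fun j => `|x j 0|)).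
have r0 : r != 0 by rewrite gt_eqF // (lt_le_trans ltr01).
have rge0 : 0 <= r by exact: le_trans r1.
rewrite -[leLHS]powRr1 // -(mulfV r0) powRrM.
apply: powR_mono; [by rewrite invr_ge0|exact: powR_ge0|].
rewrite (bigD1 j) //= lerDl; apply: sumr_ge0 => ? _; exact: powR_ge0.
Qed.

Lemma pnorm_eq0 x : pnorm p x = 0 -> x = 0.
Proof.
move=> x0; apply/colP => j; rewrite [RHS]mxE; apply/eqP.
by rewrite -normr_le0 -x0 coord_le_pnorm.
Qed.

Lemma pnorm_triangle x y : pnorm p (x + y) <= pnorm p x + pnorm p y.
Proof.
have [/pnorm_eq0 ->|x0] := eqVneq (pnorm p x) 0; first by rewrite pnorm0 !add0r.
have [/pnorm_eq0 ->|y0] := eqVneq (pnorm p y) 0; first by rewrite pnorm0 !addr0.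
have : 0 < pnorm p y by rewrite lt_neqAle eq_sym y0 pnorm_ge0.
have : 0 < pnorm p x by rewrite lt_neqAle eq_sym x0 pnorm_ge0.
move=> {x0 y0}.
have [[r r1 ->]|->] := exponent_cases; last first.
  rewrite /pnorm.
  move=> A0 B0; apply: bigmax_le => [|j _]; first by rewrite addr_ge0 // ltW.
  rewrite mxE (le_trans (ler_normD _ _)) // lerD //.
    exact: (le_bigmax _ (fun j => `|x j 0|)).
  exact: (le_bigmax _ (fun j => `|y j 0|)).
have r0 : r != 0 by rewrite gt_eqF // (lt_le_trans ltr01).
have rge0 : 0 <= r by exact: le_trans r1.
have sE z : pnorm r%:E z `^ r = \sum_(j < n) `|z j 0| `^ r.
  by rewrite -powRrM mulVf // powRr1 ?sum_powR_ge0.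
move: (sE x) (sE y).
move: (pnorm r%:E x) (pnorm r%:E y) => A B EA EB A0 B0; rewrite /pnorm.
have AB0 : 0 < A + B by exact: addr_gt0.
have Ar0 : A `^ r != 0 by rewrite gt_eqF // powR_gt0.
have Br0 : B `^ r != 0 by rewrite gt_eqF // powR_gt0.
rewrite -[leRHS]powRr1 ?(ltW AB0) // -(mulfV r0) powRrM.
apply: powR_mono; [by rewrite invr_ge0|exact: sum_powR_ge0|].
suff h j : `|(x + y) j 0| `^ r <=
    (A + B) `^ r * (A / (A + B) * (`|x j 0| `^ r / A `^ r)
                    + B / (A + B) * (`|y j 0| `^ r / B `^ r)).
  apply: (le_trans (ler_sum _ (fun j _ => h j))).
  rewrite -mulr_sumr big_split /= -!mulr_sumr -!mulr_suml -EA -EB !mulfV // !mulr1.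
  by rewrite -mulrDl mulfV ?mulr1 // gt_eqF.
rewrite mxE; apply: (@le_trans _ _ ((`|x j 0| + `|y j 0|) `^ r)).
  by apply: powR_mono => //; exact: ler_normD.
exact: powR_add_le.
Qed.

Lemma pnorm_sum (I : finType) (F : I -> 'cV[R]_n) :
  pnorm p (\sum_i F i) <= \sum_i pnorm p (F i).
Proof.
elim/big_rec2: _ => [|i a b _ hab]; first by rewrite pnorm0.
by apply: le_trans (pnorm_triangle _ _) _; rewrite lerD2l.
Qed.

End PNorm.

(** * The operator norm *)

Section OpNorm.
Context {R : realType} {n : nat} (p : \bar R) (hp : (1 <= p)%E).
Implicit Types (x : 'cV[R]_n) (A : 'M[R]_n).

(** The unit ball of the p-norm lies in the unit cube, so a bound on the entries
    of a matrix bounds its values on that ball. The bound depends on [A] only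
    through [B], which later makes it uniform over a family of matrices. *)
Lemma pnorm_mulmx_le_entries A B x : 0 <= B -> (forall a b, `|A a b| <= B) ->
  pnorm p x <= 1 -> pnorm p (A *m x) <= pnorm p (const_mx (n%:R * B) : 'cV[R]_n).
Proof.
move=> B0 hA hx; apply: pnorm_mono => // j; rewrite !mxE.
apply: le_trans (ler_norm_sum _ _ _) _.
rewrite ger0_norm ?mulr_ge0 // -[n in n%:R]card_ord mulr_natl -sumr_const.
apply: ler_sum => l _; rewrite normrM -[leRHS]mulr1 ler_pM //.
exact: le_trans (coord_le_pnorm p hp x l) hx.
Qed.

Lemma opnorm_has_ubound A :
  has_ubound [set pnorm p (A *m x) | x in [set x | pnorm p x <= 1]].
Proof.
pose B := \sum_a \sum_b `|A a b|.
exists (pnorm p (const_mx (n%:R * B) : 'cV[R]_n)) => _ [x hx <-].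
apply: pnorm_mulmx_le_entries => //.
  by rewrite !sumr_ge0 // => i _; rewrite sumr_ge0.
move=> a b; rewrite /B (bigD1 a) //= (bigD1 b) //= -addrA lerDl addr_ge0 ?sumr_ge0 //.
by move=> i _; rewrite sumr_ge0.
Qed.

Lemma opnorm_ge0 A : 0 <= opnorm p A.
Proof.
apply: ub_le_sup; first exact: opnorm_has_ubound.
by exists 0 => /=; rewrite ?mulmx0 pnorm0 // ler01.
Qed.

Lemma opnorm_le_entries A B : 0 <= B -> (forall a b, `|A a b| <= B) ->
  opnorm p A <= pnorm p (const_mx (n%:R * B) : 'cV[R]_n).
Proof.
move=> B0 hA; apply: ge_sup.
  by exists (pnorm p (A *m 0)), 0 => //=; rewrite pnorm0.
by move=> _ [x hx <-]; exact: pnorm_mulmx_le_entries.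
Qed.

Lemma pnorm_mulmx A x : pnorm p (A *m x) <= opnorm p A * pnorm p x.
Proof.
have [/(pnorm_eq0 p hp) ->|x0] := eqVneq (pnorm p x) 0.
  by rewrite mulmx0 pnorm0 // mulr0.
have xp : 0 < pnorm p x by rewrite lt_neqAle eq_sym x0 pnorm_ge0.
have h : pnorm p (A *m ((pnorm p x)^-1 *: x)) <= opnorm p A.
  apply: ub_le_sup; first exact: opnorm_has_ubound.
  exists ((pnorm p x)^-1 *: x) => //=.
  by rewrite pnormZ // gtr0_norm ?invr_gt0 // mulVf.
rewrite -ler_pdivrMr // mulrC; apply: le_trans h.
by rewrite -scalemxAr pnormZ // gtr0_norm ?invr_gt0.
Qed.

End OpNorm.

(** * Componentwise minima and maxima *)

Section MinMax.
Context {R : realType} {n k : nat}.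
Implicit Types v : 'I_k.+1 -> 'cV[R]_n.

Lemma min_col_le v i j : min_col v j 0 <= v i j 0.
Proof. by rewrite mxE; exact: (bigmin_le _ i (fun i => v i j 0)). Qed.

Lemma min_col_attained v j : exists i, min_col v j 0 = v i j 0.
Proof.
rewrite mxE; elim/big_ind: _ => [|a b [i ->] [i' ->]|i _]; first by exists ord0.
  by rewrite minEle; case: ifP => _; [exists i|exists i'].
by exists i.
Qed.

Lemma max_col_ge v i j : v i j 0 <= max_col v j 0.
Proof. by rewrite mxE; exact: (le_bigmax _ (fun i => v i j 0)). Qed.

Lemma max_col_attained v j : exists i, max_col v j 0 = v i j 0.
Proof.
rewrite mxE; elim/big_ind: _ => [|a b [i ->] [i' ->]|i _]; first by exists ord0.
  by rewrite maxEle; case: ifP => _; [exists i'|exists i].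
by exists i.
Qed.

End MinMax.

(** * Diagonal partitions of the identity *)

Section Partitions.
Context {R : realType} {n k : nat}.
Implicit Types (D M : 'I_k.+1 -> 'M[R]_n) (w : 'I_n -> 'I_k.+1 -> R).

Lemma diag_mulmxE m (A : 'M[R]_n) (B : 'M[R]_(n, m)) j l :
  is_diag_mx A -> (A *m B) j l = A j j * B j l.
Proof.
move=> /is_diag_mxP hA; rewrite mxE (bigD1 j) //= big1 ?addr0 // => i ij.
by rewrite hA ?mul0r // eq_sym.
Qed.

Definition weight_diag w : 'I_k.+1 -> 'M[R]_n :=
  fun i => diag_mx (\row_j w j i).

Lemma weight_diagE w i j : weight_diag w i j j = w j i.
Proof. by rewrite !mxE eqxx mulr1n. Qed.

Lemma weight_diag_partition w :
  (forall j i, 0 <= w j i) -> (forall j, \sum_i w j i = 1) ->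
  diag_partition (weight_diag w).
Proof.
move=> w0 w1; split=> [i|i j|]; first exact: diag_mx_is_diag.
  by rewrite weight_diagE w0 /= -(w1 j) (bigD1 i) //= lerDl sumr_ge0.
apply/matrixP => a b; rewrite summxE mxE.
under eq_bigr do rewrite !mxE.
by case: eqVneq => [_|_]; [rewrite -(w1 a)|rewrite big1].
Qed.

Lemma diag_partition_sum D j : diag_partition D -> \sum_i D i j j = 1.
Proof.
move=> [_ _ /matrixP /(_ j j)]; by rewrite summxE mxE eqxx.
Qed.

(** Two weights per row suffice: if [a <= 0 <= b] are entries of row [j], put
    [t = b / (b - a)] on [a] and [1 - t] on [b]. *)
Lemma diag_partition_zero (u : 'I_k.+1 -> 'cV[R]_n) :
  (forall j, exists i, u i j 0 <= 0) -> (forall j, exists i, 0 <= u i j 0) ->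
  exists2 D, diag_partition D & \sum_i D i *m u i = 0.
Proof.
move=> /fin_all_exists[f hf] /fin_all_exists[g hg].
(* When both chosen entries are 0, the quotient is 0 / 0 = 0 and the whole
   weight goes to [g j], which is still correct. *)
pose t j := u (g j) j 0 / (u (g j) j 0 - u (f j) j 0).
have t0 j : 0 <= t j.
  by rewrite divr_ge0 // subr_ge0 (le_trans (hf j)).
have t1 j : t j <= 1.
  have [e|ne] := eqVneq (u (g j) j 0 - u (f j) j 0) 0.
    by rewrite /t e invr0 mulr0 ler01.
  rewrite ler_pdivrMr ?mul1r ?lerDl ?oppr_ge0 //.
  by rewrite lt_neqAle eq_sym ne subr_ge0 (le_trans (hf j)).
pose w j i := t j * (i == f j)%:R + (1 - t j) * (i == g j)%:R.
have sumw j (F : 'I_k.+1 -> R) :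
    \sum_i w j i * F i = t j * F (f j) + (1 - t j) * F (g j).
  have pick i0 (a : R) : \sum_i a * (i == i0)%:R * F i = a * F i0.
    rewrite (bigD1 i0) //= eqxx mulr1 big1 ?addr0 // => i /negbTE ->.
    by rewrite mulr0 mul0r.
  by under eq_bigr do rewrite mulrDl; rewrite big_split /= !pick.
exists (weight_diag w).
  apply: weight_diag_partition => [j i|j].
    by apply: addr_ge0; apply: mulr_ge0; rewrite ?ler0n ?subr_ge0 ?t0 ?t1.
  by have := sumw j (fun=> 1); under eq_bigr do rewrite mulr1;
    move=> ->; rewrite !mulr1 subrKC.
apply/colP => j; rewrite summxE [RHS]mxE.
under eq_bigr do rewrite diag_mulmxE ?diag_mx_is_diag // weight_diagE.
rewrite sumw /t.
have [e|ne] := eqVneq (u (g j) j 0 - u (f j) j 0) 0; last by field.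
rewrite e invr0 mulr0 mul0r add0r subr0 mul1r; apply/eqP.
rewrite eq_le hg andbT.
by move/eqP: e; rewrite subr_eq0 => /eqP ->.
Qed.

Lemma S_mx_mulmx m M D (x : 'M[R]_(n, m)) :
  S_mx M D *m x = \sum_i D i *m (M i *m x).
Proof.
by rewrite /S_mx mulmx_suml; apply: eq_bigr => i _; rewrite mulmxA.
Qed.

Lemma S_mxE M D j l : diag_partition D ->
  S_mx M D j l = \sum_i D i j j * M i j l.
Proof.
move=> [hD _ _]; rewrite /S_mx summxE; apply: eq_bigr => i _.
by rewrite diag_mulmxE.
Qed.

(** Row [j] of [S_mx M D *m x] is a convex combination of the numbers
    [(M i *m x) j 0]; if it vanishes, 0 lies between their minimum and their
    maximum. *)
Lemma S_mx_inj M D x : row_W_property M -> diag_partition D ->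
  S_mx M D *m x = 0 :> 'cV[R]_n -> x = 0.
Proof.
move=> hW hD; rewrite S_mx_mulmx => Sx.
have [dD D01 _] := hD.
have eqj j : \sum_i D i j j * (M i *m x) j 0 = 0.
  move/colP: Sx => /(_ j); rewrite summxE [RHS]mxE => Sxj; rewrite -[RHS]Sxj.
  by apply: eq_bigr => i _; rewrite [RHS]diag_mulmxE.
apply: hW => j.
  rewrite -[leRHS](eqj j) -[leLHS]mul1r -(diag_partition_sum D j hD) mulr_suml.
  by apply: ler_sum => i _; rewrite ler_wpM2l ?min_col_le //; case/andP: (D01 i j).
rewrite -[leLHS](eqj j) -[leRHS]mul1r -(diag_partition_sum D j hD) mulr_suml.
by apply: ler_sum => i _; rewrite ler_wpM2l ?(max_col_ge (fun i => M i *m x)) //;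
  case/andP: (D01 i j).
Qed.

Lemma S_mx_det_neq0 M D : row_W_property M -> diag_partition D ->
  \det (S_mx M D) != 0.
Proof.
move=> hW hD; rewrite -det_tr; apply/det0P => -[v v0].
move=> /(congr1 trmx); rewrite trmx_mul trmxK trmx0 => /(S_mx_inj M D _ hW hD).
by move=> /(congr1 trmx); rewrite trmxK trmx0 => /eqP; apply/negP.
Qed.

End Partitions.

(** * A uniform bound on the inverses of the row mixtures *)

Section Det.
Context {R : realType} {n k : nat}.
Implicit Types (D M : 'I_k.+1 -> 'M[R]_n).

(** Along the segment the determinant is a polynomial in [t], so the intermediate
    value theorem for polynomials applies. *)
Lemma det_segment_root (A B : 'M[R]_n) : \det A * \det B < 0 ->
  exists2 t : R, 0 <= t <= 1 & \det ((1 - t) *: A + t *: B) = 0.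
Proof.
pose P : {poly R} := \det (map_mx polyC A + 'X *: map_mx polyC (B - A)).
have PE t : P.[t] = \det ((1 - t) *: A + t *: B).
  rewrite -[P.[t]]/(horner_eval t P) -det_map_mx; congr (\det _).
  apply/matrixP => a b; rewrite !mxE /= /horner_eval !hornerE; ring.
have P0 : P.[0] = \det A by rewrite PE subr0 scale1r scale0r addr0.
have P1 : P.[1] = \det B by rewrite PE subrr scale1r scale0r add0r.
have root (Q : {poly R}) : Q.[0] < 0 -> 0 < Q.[1] ->
    exists2 t : R, 0 <= t <= 1 & Q.[t] = 0.
  move=> q0 q1; have [|t ht /rootP Qt] := @poly_ivt R Q 0 1 ler01.
    by rewrite !ltW.
  by exists t.
rewrite -P0 -P1 => hP.
have [h0|h0|h0] := ltgtP P.[0] 0; last by rewrite h0 mul0r ltxx in hP.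
  have [//||t ht Pt] := root P; first by rewrite nmulr_rlt0 in hP.
  by exists t; rewrite // -PE.
have [|//|t ht Pt] := root (- P); rewrite ?hornerN ?oppr_lt0 ?oppr_gt0 //.
  by rewrite pmulr_rlt0 in hP.
by exists t; rewrite // -PE; apply/eqP; rewrite -oppr_eq0 -hornerN Pt.
Qed.

Lemma diag_partition_conv D D' t : diag_partition D -> diag_partition D' ->
  0 <= t <= 1 -> diag_partition (fun i => (1 - t) *: D i + t *: D' i).
Proof.
move=> [d1 d2 d3] [e1 e2 e3] /andP[t0 t1]; split=> [i|i j|].
- apply/is_diag_mxP => a b ab; rewrite !mxE.
  by rewrite (is_diag_mxP (d1 i)) // (is_diag_mxP (e1 i)) // !mulr0 addr0.
- rewrite !mxE; have /andP[? ?] := d2 i j; have /andP[? ?] := e2 i j.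
  by apply/andP; split; nra.
- by rewrite big_split /= -!scaler_sumr d3 e3 -scalerDl subrK scale1r.
Qed.

(** The partitions form a convex set on which the determinant never vanishes. *)
Lemma S_mx_det_same_sign M D D' : row_W_property M ->
  diag_partition D -> diag_partition D' ->
  0 < \det (S_mx M D) * \det (S_mx M D').
Proof.
move=> hW hD hD'; rewrite lt_neqAle eq_sym mulf_neq0 ?S_mx_det_neq0 //=.
rewrite leNgt; apply/negP => /det_segment_root[t ht].
have -> : (1 - t) *: S_mx M D + t *: S_mx M D' =
          S_mx M (fun i => (1 - t) *: D i + t *: D' i).
  rewrite /S_mx !scaler_sumr -big_split; apply: eq_bigr => i _ /=.
  by rewrite mulmxDl -!scalemxAl.
by apply/eqP/S_mx_det_neq0 => //; exact: diag_partition_conv.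
Qed.

Definition vertex (f : {ffun 'I_n -> 'I_k.+1}) : 'I_k.+1 -> 'M[R]_n :=
  weight_diag (fun j i => (i == f j)%:R).

Lemma vertex_partition f : diag_partition (vertex f).
Proof.
apply: weight_diag_partition => [j i|j]; first exact: ler0n.
by rewrite (bigD1 (f j)) //= eqxx big1 ?addr0 // => i /negbTE ->.
Qed.

Lemma S_mx_vertexE M f j l : S_mx M (vertex f) j l = M (f j) j l.
Proof.
rewrite S_mxE; last exact: vertex_partition.
under eq_bigr do rewrite weight_diagE.
rewrite (bigD1 (f j)) //= eqxx mul1r big1 ?addr0 // => i /negbTE ->.
by rewrite mul0r.
Qed.

(** Multilinearity of the determinant in its rows: row [j] of [S_mx M D] is the
    combination of the rows [j] of the [M i] with weights [D i j j]. *)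
Lemma det_S_mx M D : diag_partition D ->
  \det (S_mx M D) =
    \sum_(f : {ffun 'I_n -> 'I_k.+1})
      (\prod_j D (f j) j j) * \det (S_mx M (vertex f)).
Proof.
move=> hD; rewrite /determinant.
under eq_bigr => s _.
  under eq_bigr do rewrite S_mxE //.
  rewrite bigA_distr_bigA /= mulr_sumr.
  over.
rewrite exchange_big /=; apply: eq_bigr => f _; rewrite mulr_sumr.
apply: eq_bigr => s _; rewrite big_split /= mulrCA; congr (_ * (_ * _)).
by apply: eq_bigr => j _; rewrite S_mx_vertexE.
Qed.

(** The coefficients of the expansion [det_S_mx] are those of a convex
    combination. *)
Lemma vertex_weights_sum D : diag_partition D ->
  \sum_(f : {ffun 'I_n -> 'I_k.+1}) \prod_j D (f j) j j = 1.
Proof.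
move=> hD; rewrite -(bigA_distr_bigA (fun j i => D i j j)) big1 // => j _.
exact: diag_partition_sum.
Qed.

(** A convex combination of finitely many nonzero numbers of one sign is, in
    absolute value, at least the smallest of them. *)
Lemma S_mx_det_bounded_away M : row_W_property M ->
  exists2 c : R, 0 < c & forall D, diag_partition D -> c <= `|\det (S_mx M D)|.
Proof.
move=> hW; pose f0 : {ffun 'I_n -> 'I_k.+1} := [ffun=> ord0].
pose V f := \det (S_mx M (vertex f)).
have V0 f : 0 < V f * V f0 by apply: S_mx_det_same_sign => //; exact: vertex_partition.
(* Multiplying by the reference value [V f0] makes every term positive, whatever
   the common sign is. *)
pose m := \big[Num.min/1]_(f : {ffun 'I_n -> 'I_k.+1}) (V f * V f0).
have m0 : 0 < m.
  by apply: (big_ind (fun a : R => 0 < a)) => // a b ha hb; rewrite lt_min ha.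
have d0 : 0 < `|V f0|.
  by rewrite normr_gt0 S_mx_det_neq0 //; exact: vertex_partition.
exists (m / `|V f0|) => [|D hD]; first exact: divr_gt0.
rewrite ler_pdivrMr // -normrM; apply: le_trans (ler_norm _).
rewrite det_S_mx // mulr_suml -[leLHS]mul1r -[X in X * m](vertex_weights_sum _ hD) mulr_suml.
apply: ler_sum => f _; rewrite -mulrA; apply: ler_wpM2l.
  by apply: prodr_ge0 => j _; have [_ /(_ (f j) j)/andP[]] := hD.
exact: (bigmin_le _ f (fun f => V f * V f0)).
Qed.

Lemma det_le_entries m (A : 'M[R]_m) B : (forall a b, `|A a b| <= B) ->
  `|\det A| <= m`!%:R * B ^+ m.
Proof.
move=> hA; apply: le_trans (ler_norm_sum _ _ _) _.
rewrite -perm.card_Sn mulr_natl -sumr_const; apply: ler_sum => s _.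
rewrite normrM normrX normrN1 expr1n mul1r normr_prod.
rewrite -[m in B ^+ m]card_ord -prodr_const.
by apply: ler_prod => j _; rewrite normr_ge0 hA.
Qed.

(** The entries of [S_mx M D] are bounded independently of [D], hence so are its
    cofactors; divide by the lower bound for the determinant. *)
Lemma S_mx_inv_entries M : row_W_property M ->
  exists2 B : R, 0 <= B &
    forall D a b, diag_partition D -> `|invmx (S_mx M D) a b| <= B.
Proof.
move=> hW; have [c c0 hc] := S_mx_det_bounded_away M hW.
pose B := \sum_i \sum_a \sum_b `|M i a b|.
have B0 : 0 <= B by do 3 (rewrite sumr_ge0 // => ? _).
exists (c^-1 * ((n.-1)`!%:R * B ^+ n.-1)) => [|D a b hD].
  by rewrite mulr_ge0 ?invr_ge0 ?(ltW c0) // mulr_ge0 ?exprn_ge0.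
have hS j l : `|S_mx M D j l| <= B.
  rewrite S_mxE //; apply: le_trans (ler_norm_sum _ _ _) _.
  apply: ler_sum => i _; rewrite normrM.
  have [_ /(_ i j)/andP[D0 D1] _] := hD.
  rewrite (ger0_norm D0); apply: le_trans (ler_piMl _ D1) _ => //.
  rewrite (bigD1 j) //= (bigD1 l) //= -addrA lerDl addr_ge0 ?sumr_ge0 //.
  by move=> ? _; rewrite sumr_ge0.
have dn0 := S_mx_det_neq0 M D hW hD.
rewrite /invmx unitmxE unitfE dn0 2!mxE normrM normfV ler_pM ?invr_ge0 //.
  by rewrite lef_pV2 ?posrE ?normr_gt0 ?hc.
rewrite /cofactor normrM normrX normrN1 expr1n mul1r.
by apply: det_le_entries => ? ?; rewrite !mxE.
Qed.

(** The content is that the set whose supremum defines [alpha] is bounded above. *)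
Lemma opnorm_le_alpha p M D i : (1 <= p)%E -> row_W_property M -> diag_partition D ->
  opnorm p (invmx (S_mx M D) *m D i) <= alpha p M i.
Proof.
move=> hp hW hD; apply: ub_le_sup; last by exists D.
have [B B0 hB] := S_mx_inv_entries M hW.
exists (pnorm p (const_mx (n%:R * B) : 'cV[R]_n)) => _ [E hE <-].
apply: opnorm_le_entries => // a b.
have [dE E01 _] := hE.
rewrite mxE (bigD1 b) //= big1 ?addr0 => [|l lb]; last first.
  by rewrite (is_diag_mxP (dE i)) ?mulr0.
have /andP[E0 E1] := E01 i b.
by rewrite normrM (ger0_norm E0) (le_trans (ler_piMr _ E1)) ?hB.
Qed.

End Det.

(** * Perturbation of the solution *)

Section Perturbation.
Context {R : realType} {n k : nat} (p : \bar R) (hp : (1 <= p)%E).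
Implicit Types (D M : 'I_k.+1 -> 'M[R]_n) (q : 'I_k.+1 -> 'cV[R]_n) (x y : 'cV[R]_n).

Lemma alpha_ge0 M i : row_W_property M -> 0 <= alpha p M i.
Proof.
move=> hW; have hD := vertex_partition (R := R) (finfun (fun _ : 'I_n => @ord0 k)).
by apply: le_trans (opnorm_le_alpha p M _ i hp hW hD); exact: opnorm_ge0.
Qed.

(** The a priori estimate: the numbers [alpha p M i] measure how a residual that is
    mixed by the same [D] as the matrix propagates to the solution. *)
Lemma pnorm_le_alpha M D x (e : 'I_k.+1 -> 'cV[R]_n) :
  row_W_property M -> diag_partition D ->
  S_mx M D *m x = \sum_i D i *m e i ->
  pnorm p x <= \sum_i alpha p M i * pnorm p (e i).
Proof.
move=> hW hD Sx.
have -> : x = \sum_i invmx (S_mx M D) *m D i *m e i.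
  under eq_bigr do rewrite -mulmxA.
  by rewrite -mulmx_sumr -Sx mulKmx // unitmxE unitfE S_mx_det_neq0.
apply: le_trans (pnorm_sum p hp _ _) _; apply: ler_sum => i _.
apply: le_trans (pnorm_mulmx p hp _ _) _; apply: ler_wpM2r.
  exact: pnorm_ge0.
exact: opnorm_le_alpha.
Qed.

Lemma solves_ge0 M q x i j : solves_EVLCP M q x -> 0 <= (M i *m x + q i) j 0.
Proof.
move=> /colP /(_ j); rewrite [RHS]mxE => <-.
exact: (min_col_le (fun i => M i *m x + q i)).
Qed.

Lemma solves_eq0 M q x j : solves_EVLCP M q x -> exists i, (M i *m x + q i) j 0 = 0.
Proof.
move=> /colP /(_ j); rewrite [RHS]mxE => hx.
by have [i hi] := min_col_attained (fun i => M i *m x + q i) j; exists i; rewrite -hi.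
Qed.

(** A solution satisfies [- q i <= M i *m x], so each entry of [(- q i)_+] is at
    most that of [|M i *m x|]. *)
Lemma pnorm_pos_part_le M q x i : solves_EVLCP M q x ->
  pnorm p (pos_part (- q i)) <= opnorm p (M i) * pnorm p x.
Proof.
move=> hx; apply: le_trans (pnorm_mulmx p hp _ _).
apply: pnorm_mono => // j; rewrite mxE.
have := solves_ge0 M q x i j hx; rewrite mxE => h.
rewrite ger0_norm ?le_max ?lexx // ge_max normr_ge0 /= [X in X <= _]mxE.
by apply: le_trans (ler_norm _); rewrite -subr_ge0 opprK.
Qed.

(** In coordinate [j], a residual of [x] that vanishes faces a nonnegative residual
    of [y] with the same index, and conversely: the differences of residuals take
    both signs. *)
Lemma solutions_difference M M' q q' x y :
  solves_EVLCP M q x -> solves_EVLCP M' q' y ->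
  exists2 D, diag_partition D &
    S_mx M D *m (x - y) = \sum_i D i *m ((M' i - M i) *m y + (q' i - q i)).
Proof.
move=> hx hy.
pose u i := (M i *m x + q i) - (M' i *m y + q' i).
have uE i j : u i j 0 = (M i *m x + q i) j 0 - (M' i *m y + q' i) j 0.
  by rewrite /u [LHS]mxE; congr (_ + _); rewrite mxE.
have [j|j|D hD Du] := diag_partition_zero u.
- have [i hi] := solves_eq0 M q x j hx; exists i.
  by rewrite uE hi sub0r oppr_le0; exact: solves_ge0.
- have [i hi] := solves_eq0 M' q' y j hy; exists i.
  by rewrite uE hi subr0; exact: solves_ge0.
exists D => //; apply/eqP; rewrite -subr_eq0 S_mx_mulmx -sumrB; apply/eqP; rewrite -[RHS]Du.
apply: eq_bigr => i _; rewrite -mulmxBr; congr (_ *m _).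
rewrite /u mulmxBr mulmxBl.
move: (M i *m x) (M i *m y) (M' i *m y) => Mx My M'y.
by apply/colP => j; rewrite !mxE; ring.
Qed.

End Perturbation.

Theorem theorem4p1 (R : realType) (n k : nat) (p : \bar R) (hp : (1 <= p)%E)
    (M dM : 'I_k.+1 -> 'M[R]_n) (q dq : 'I_k.+1 -> 'cV[R]_n)
    (eps : 'I_k.+1 -> R)
    (hW : row_W_property M)
    (heps : forall i, 0 <= eps i)
    (hdM : forall i, opnorm p (dM i) <= eps i * opnorm p (M i))
    (hdq : forall i, pnorm p (dq i) <= eps i * pnorm p (pos_part (- q i))) :
  let eta := \sum_(i < k.+1) eps i * alpha p M i * opnorm p (M i) in
  let M' := fun i => M i + dM i in
  let q' := fun i => q i + dq i in
  eta < 1 ->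
  row_W_property M' /\
  (forall x y : 'cV[R]_n,
     solves_EVLCP M q x -> solves_EVLCP M' q' y ->
     pnorm p (x - y) / pnorm p x <= 2 * eta / (1 - eta)).
Proof.
move=> eta M' q' eta1.
have a0 i : 0 <= alpha p M i by exact: alpha_ge0.
have dM_le i (z : 'cV[R]_n) :
    pnorm p (dM i *m z) <= eps i * opnorm p (M i) * pnorm p z.
  apply: le_trans (pnorm_mulmx p hp _ _) _.
  by apply: ler_wpM2r; [exact: pnorm_ge0|exact: hdM].
have eta_mul c : eta * c =
    \sum_i alpha p M i * (eps i * opnorm p (M i) * c).
  by rewrite /eta mulr_suml; apply: eq_bigr => i _; ring.
split=> [z hmin hmax|x y hx hy].
  have [j|j|D hD Dz] := diag_partition_zero (fun i => M' i *m z).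
  - by have [i hi] := min_col_attained (fun i => M' i *m z) j; exists i; rewrite -hi.
  - by have [i hi] := max_col_attained (fun i => M' i *m z) j; exists i; rewrite -hi.
  have Sz : S_mx M D *m z = \sum_i D i *m (- (dM i *m z)).
    apply/eqP; rewrite -subr_eq0 S_mx_mulmx -sumrB; apply/eqP; rewrite -[RHS]Dz.
    by apply: eq_bigr => i _; rewrite -mulmxBr opprK -mulmxDl.
  apply: (pnorm_eq0 p hp).
  have z0 : 0 <= pnorm p z by exact: pnorm_ge0.
  have : pnorm p z <= eta * pnorm p z.
    rewrite eta_mul; apply: le_trans (pnorm_le_alpha p hp M D z _ hW hD Sz) _.
    by apply: ler_sum => i _; apply: ler_wpM2l => //; rewrite pnormN.
  move: z0; move: (pnorm p z) => a a_ge0 a_le.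
  by apply/eqP; rewrite eq_le a_ge0 andbT; nra.
have [D hD Sxy] := solutions_difference M M' q q' x y hx hy.
have key : pnorm p (x - y) <= eta * (pnorm p y + pnorm p x).
  rewrite eta_mul; apply: le_trans (pnorm_le_alpha p hp M D _ _ hW hD Sxy) _.
  apply: ler_sum => i _; apply: ler_wpM2l => //.
  rewrite /M' /q' !(addrC _ (- _)) !addKr.
  apply: le_trans (pnorm_triangle p hp _ _) _; rewrite mulrDr.
  apply: lerD; first exact: dM_le.
  apply: le_trans (hdq i) _; rewrite -mulrA; apply: ler_wpM2l => //.
  exact: pnorm_pos_part_le.
have eta0 : 0 <= eta.
  rewrite /eta; apply: sumr_ge0 => i _; apply: mulr_ge0; last exact: opnorm_ge0.
  by apply: mulr_ge0.
have eta1' : 0 < 1 - eta by rewrite subr_gt0.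
have [->|x0] := eqVneq (pnorm p x) 0.
  by rewrite invr0 mulr0 divr_ge0 ?mulr_ge0 // ltW.
have xp : 0 < pnorm p x by rewrite lt_neqAle eq_sym x0 pnorm_ge0.
have y_le : pnorm p y <= pnorm p x + pnorm p (x - y).
  rewrite -[pnorm p (x - y)](pnormN p hp); apply: le_trans (pnorm_triangle p hp _ _).
  by rewrite opprB addrC subrK.
rewrite ler_pdivrMr // mulrAC ler_pdivlMr //.
move: key y_le; move: (pnorm p (x - y)) (pnorm p x) (pnorm p y) => a b c key y_le.
have : eta * c <= eta * (b + a) by apply: ler_wpM2l.
by nra.
Qed.
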